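(* Let $1\le m<\infty$, let $\Lambda=\{\lambda_{\alpha}\}_{\alpha\in A_m}$ be a weight set for $A_m$ satisfying $( * )$ and $( ** )$, and let $1\le k<\infty$. Then for every finite set of monomials $\{Z^{\alpha^i}\otimes x_i\}_{i=1}^n$ with $\{\alpha^i\}\subset A_m$ and $\{x_i\}\subset\mathbb{C}^k$, the submodule $\mathcal{S}$ of $\mathcal{M}_\Lambda\otimes\mathbb{C}^k$ generated by this set is essentially reductive.
   Context: $A_m$ is the set of multi-indices $\alpha=(\alpha_1,\dots,\alpha_m)$ of non-negative integers, $e_i$ is the multi-index with $1$ in position $i$ and $0$ elsewhere, and $Z^{\alpha}=z_1^{\alpha_1}\cdots z_m^{\alpha_m}$ in $\mathbb{C}[z]=\mathbb{C}[z_1,\dots,z_m]$. A weight set is a family $\Lambda=\{\lambda_\alpha\}_{\alpha\in A_m}$ with $0<\lambda_\alpha<\infty$. $\mathcal{M}_\Lambda$ is the Hilbert space completion of $\mathbb{C}[z]$ in which the monomials $\{Z^\alpha\}_{\alpha\in A_m}$ form an orthogonal set (with dense span) and $\|Z^\alpha\|=\lambda_\alpha$. $Z_i$ denotes the operator on $\mathcal{M}_\Lambda$ of multiplication by $z_i$, i.e. $Z_iZ^\alpha=Z^{\alpha+e_i}$. Condition $( * )$: $\lambda_\alpha\ge\lambda_{\alpha+e_i}$ for all $\alpha\in A_m$ and $1\le i\le m$ (so each $Z_i$ is a contraction and $\mathcal{M}_\Lambda$ is a Hilbert module over $\mathbb{C}[z]$, i.e. polynomials act by bounded operators). Condition $(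 ** )$: $[Z_i,Z_j^*]$ is compact for all $1\le i,j\le m$. $\mathcal{M}_\Lambda\otimes\mathbb{C}^k$ is the Hilbert module over $\mathbb{C}[z]$ on which $z_i$ acts by $Z_i\otimes I_{\mathbb{C}^k}$. A submodule is a closed subspace invariant under the module action; the submodule generated by a set is the smallest submodule containing it. A Hilbert module over $\mathbb{C}[z]$ is essentially reductive if for every $\varphi\in\mathbb{C}[z]$ the operator $M_\varphi$ of module multiplication by $\varphi$ has compact self-commutator $M_\varphi^*M_\varphi-M_\varphi M_\varphi^*$. *)

(* Defs.v *)
(* Library: MathComp / MathComp-Analysis, with complex scalars R[i] over a
   realType R.  The notations of multinomials clash with those of
   MathComp-Analysis, hence the import without notations: below, multinom m is
   the type of multi-indices in m variables, mpoly m R[i] the polynomial ring,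
   mpolyX R[i] a the monomial with exponent a, and mnm1 i the unit
   multi-index e_i. *)
From HB Require Import structures.
From mathcomp Require Import all_boot all_order all_algebra.
From mathcomp Require Import sesquilinear spectral.
From mathcomp Require Import all_classical all_reals all_analysis.
From mathcomp Require Import complex.
From mathcomp Require Import -(notations) mpoly.

Set Implicit Arguments.
Unset Strict Implicit.
Unset Printing Implicit Defensive.

Import Order.TTheory GRing.Theory Num.Theory Num.Def.
Import numFieldNormedType.Exports.

Local Open Scope classical_set_scope.
Local Open Scope ring_scope.
Local Open Scope complex_scope.

(* The form is linear in its first argument. *)
Record hilbertSpace (R : realType) := HilbertSpace {
  hs_sort :> completeNormedModType R[i];
  hs_dot : {dot hs_sort for conjC};
  hs_normE : forall x : hs_sort, `|x| ^+ 2 = hs_dot x x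
}.

Section Operators.
Variables (R : realType) (H : hilbertSpace R).
Implicit Types (S : set H) (T A : H -> H).

Definition closed_subspace S :=
  [/\ closed S, S 0 & forall (c : R[i]) x y, S x -> S y -> S (c *: x + y)].

(* A closed subspace S is a Hilbert space for the inherited inner product; the
   next two definitions concern operators of S, given as maps on H that send S
   to S.  For S = setT they are the usual notions on H. *)
Definition adjoint_on S T A :=
  (forall x, S x -> S (A x)) /\
  (forall x y, S x -> S y -> hs_dot H (T x) y = hs_dot H x (A y)).

Definition compact_on S T := precompact (T @` [set x | S x /\ `|x| <= 1]).

Definition commutator T A : H -> H := fun x => T (A x) - A (T x).

End Operators.

Record hilbertModule (R : realType) (m : nat) := HilbertModule {
  hm_space :> hilbertSpace R;
  hm_act : mpoly m R[i] -> {linear hm_space -> hm_space};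
  hm_act_continuous : forall p, continuous (hm_act p);
  hm_act1 : forall x, hm_act 1 x = x;
  hm_actM : forall p q x, hm_act (p * q) x = hm_act p (hm_act q x);
  hm_actD : forall p q x, hm_act (p + q) x = hm_act p x + hm_act q x;
  hm_actZ : forall c p x, hm_act (c *: p) x = c *: hm_act p x
}.

Definition coord_op (R : realType) (m : nat) (M : hilbertModule R m)
  (i : 'I_m) : M -> M := hm_act M (mpolyX R[i] (mnm1 i)).

Definition submodule (R : realType) (m : nat) (M : hilbertModule R m)
    (S : set M) :=
  closed_subspace S /\ forall p x, S x -> S (hm_act M p x).

Definition generated_submodule (R : realType) (m : nat)
  (M : hilbertModule R m) (G : set M) : set M := smallest (@submodule R m M) G.

(* Essential reductivity of the submodule S: the adjoint is that of the
   restriction of hm_act M p to S, taken in S, and compactness is that of an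
   operator on S. *)
Definition essentially_reductive (R : realType) (m : nat)
    (M : hilbertModule R m) (S : set M) :=
  forall p, exists A : M -> M,
    adjoint_on S (hm_act M p) A /\ compact_on S (commutator A (hm_act M p)).

Definition weight_set (R : realType) (m : nat) (L : multinom m -> R) :=
  forall a, 0 < L a.

Definition weights_nonincreasing (R : realType) (m : nat)
    (L : multinom m -> R) :=
  forall a i, L (mnm_add a (mnm1 i)) <= L a.

Definition cross_commutators_compact (R : realType) (m : nat)
    (M : hilbertModule R m) :=
  forall i j, exists A : M -> M,
    adjoint_on setT (@coord_op R m M j) A /\
    compact_on setT (commutator (@coord_op R m M i) A).

(* The completion of the polynomial ring for the inner product attached to L,
   through the universal presentation: a Hilbert module receiving the
   polynomials by wm_emb as a dense submodule.  It is unique up to a unitary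
   module isomorphism, and exists as soon as every coordinate multiplication
   is bounded, in particular when L is nonincreasing. *)
Record weightedModule (R : realType) (m : nat) (L : multinom m -> R) :=
  WeightedModule {
  wm_module :> hilbertModule R m;
  wm_emb : {linear mpoly m R[i] -> wm_module};
  wm_dense : closure (range wm_emb) = setT;
  wm_orthogonal : forall a b, a <> b ->
    hs_dot wm_module (wm_emb (mpolyX R[i] a)) (wm_emb (mpolyX R[i] b)) = 0;
  wm_norm : forall a, `|wm_emb (mpolyX R[i] a)| = (L a)%:C;
  wm_act : forall p q, hm_act wm_module p (wm_emb q) = wm_emb (p * q)
}.

(* The Hilbert module tensor product of M and C^k, with z_i acting by
   Z_i (x) id.  C^k is 'rV[R[i]]_k with its standard inner product dotmx. *)
Record amplification (R : realType) (m : nat) (M : hilbertModule R m)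
    (k : nat) := Amplification {
  amp_module :> hilbertModule R m;
  amp_tensor : {bilinear M -> 'rV[R[i]]_k -> amp_module};
  amp_dot : forall a b x y,
    hs_dot amp_module (amp_tensor a x) (amp_tensor b y) =
    hs_dot M a b * dotmx x y;
  amp_dense : smallest (@closed_subspace R amp_module)
    [set u | exists a x, u = amp_tensor a x] = setT;
  amp_act : forall i a x,
    coord_op i (amp_tensor a x) = amp_tensor (coord_op i a) x
}.

Definition monomial_tensor (R : realType) (m : nat) (L : multinom m -> R)
  (M : weightedModule L) (k : nat) (H : amplification M k) (a : multinom m)
  (x : 'rV[R[i]]_k) : H := amp_tensor H (wm_emb M (mpolyX R[i] a)) x.

(* Main.v *)
Require Import Defs.
From mathcomp Require Import all_boot all_order all_algebra.
From mathcomp Require Import sesquilinear spectral.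
From mathcomp Require Import all_classical all_reals all_analysis.
From mathcomp Require Import complex.
From mathcomp Require Import finmap ring lra.
From mathcomp Require Import -(notations) mpoly.

(* Write Z_j for the coordinate operators on H = M (x) C^k, P for the projection
   on S, and F_n for the projection on the closed span of the monomials of degree
   less than n in z_j, so that F_(n+1) Z_j = Z_j F_n.  Since [Z_j^*, Z_j] is
   compact on H and T is compact as soon as T^* T is, induction on n shows that
   Z_j^* F_n is compact for every n.  S is the closed span of the multiples of
   its generators, and Z_j^* maps such a multiple back into S as soon as its
   degree in z_j is at least n = 1 + max_i alpha^i_j; hence
   (1 - P) Z_j^* P = (1 - P) Z_j^* F_n P is compact.  Therefore (1 - P) B P is
   compact for the adjoint B of every polynomial, and the essential reductivity
   of H passes to S. *)

Import Order.TTheory GRing.Theory Num.Theory.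
Import numFieldNormedType.Exports.

Local Open Scope classical_set_scope.
Local Open Scope ring_scope.
Local Open Scope complex_scope.

Set Implicit Arguments.
Unset Strict Implicit.
Unset Printing Implicit Defensive.

(** * Real-valued norm and inner product *)

Lemma real_complexE (R : realType) (c : R[i]) :
  c \is Num.real -> c = (complex.Re c)%:C.
Proof. by case: c => a b; rewrite complex_real => /eqP ->. Qed.

(** Norms over [R[i]] are complex numbers; taking the real part moves every estimate into the
    ordered field [R], where [lra] and [nra] apply. *)
Definition nrm (R : realType) (V : normedZmodType R[i]) (x : V) : R :=
  complex.Re `|x|.

Section RealNorm.
Variables (R : realType) (V : normedZmodType R[i]).
Implicit Types x y : V.

Lemma normE x : `|x| = (nrm x)%:C.
Proof. exact/real_complexE/normr_real. Qed.

Lemma norm_le1 x : (`|x| <= 1) = (nrm x <= 1).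
Proof. by rewrite normE -(rmorph1 (real_complex R)) lecR. Qed.

Lemma nrm_ge0 x : 0 <= nrm x.
Proof. by have := normr_ge0 x; rewrite normE lecR. Qed.

Lemma nrm0 : nrm (0 : V) = 0.
Proof. by rewrite /nrm normr0. Qed.

Lemma nrm0_eq0 x : nrm x = 0 -> x = 0.
Proof. by move=> h; apply/eqP; rewrite -normr_eq0 normE h. Qed.

Lemma nrmN x : nrm (- x) = nrm x.
Proof. by rewrite /nrm normrN. Qed.

Lemma nrmBC x y : nrm (x - y) = nrm (y - x).
Proof. by rewrite -nrmN opprB. Qed.

Lemma ler_nrmD x y : nrm (x + y) <= nrm x + nrm y.
Proof. by have := ler_normD x y; rewrite !normE -rmorphD /= lecR. Qed.

Lemma ler_nrmB3 x y z : nrm (x - z) <= nrm (x - y) + nrm (y - z).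
Proof. by rewrite -[x - z](subrKA y); exact: ler_nrmD. Qed.

End RealNorm.

Lemma nrmM (R : realType) (c d : R[i]) : nrm (c * d) = nrm c * nrm d.
Proof. by apply/complexI; rewrite rmorphM /= -!normE normrM. Qed.

Lemma nrmC_real (R : realType) (c : R) : 0 <= c -> nrm c%:C = c.
Proof. by move=> c0; rewrite /nrm ger0_norm ?lecR. Qed.

Lemma ler_Re_nrm (R : realType) (c : R[i]) : complex.Re c <= nrm c.
Proof.
by apply: le_trans (ler_norm _) _; rewrite -lecR -normE; exact: normc_ge_Re.
Qed.

Section RealNormTopology.
Variables (R : realType) (V : normedModType R[i]).
Implicit Types (x y : V) (F : set_system V).

Lemma nrmZ (c : R[i]) x : nrm (c *: x) = nrm c * nrm x.
Proof. by apply/complexI; rewrite rmorphM /= -!normE normrZ. Qed.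

Lemma nbhs_nrm x (A : set V) :
  nbhs x A <-> exists2 e : R, 0 < e & forall y, nrm (x - y) < e -> A y.
Proof.
split=> [/nbhs_ballP[e /= e0 eA]|[e e0 eA]].
  have er := real_complexE (gtr0_real e0).
  exists (complex.Re e); first by rewrite -ltcR -er.
  by move=> y xy; apply: eA; rewrite -ball_normE /ball_ /= er normE ltcR.
apply/nbhs_ballP; exists e%:C; first by rewrite /= ltcR.
by move=> y; rewrite -ball_normE /ball_ /= normE ltcR => /eA.
Qed.

Lemma closure_nrm (A : set V) x :
  closure A x <-> forall e : R, 0 < e -> exists2 y, A y & nrm (x - y) < e.
Proof.
split=> [Ax e e0|h B /nbhs_nrm[e e0 eB]].
  have [|y [Ay yx]] := Ax [set y | nrm (x - y) < e].
    by apply/nbhs_nrm; exists e.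
  by exists y.
by have [y Ay xy] := h e e0; exists y; split => //; exact: eB.
Qed.

End RealNormTopology.

Lemma cauchy_nrm (R : realType) (V : completeNormedModType R[i])
    (F : set_system V) : ProperFilter F ->
  (forall e : R, 0 < e -> exists x, F [set y | nrm (x - y) < e]) -> cvg F.
Proof.
move=> FF h; apply/cauchy_cvgP; apply: cauchy_exP => e e0.
have er := real_complexE (gtr0_real e0).
have [|x Fx] := h (complex.Re e); first by rewrite -ltcR -er.
exists x; apply: filterS Fx => y xy.
by rewrite -ball_normE /ball_ /= er normE ltcR.
Qed.

Section InnerProduct.
Variables (R : realType) (H : hilbertSpace R).
Implicit Types (x y z u v : H) (c : R[i]).

Local Notation "''[' x , y ]" := (hs_dot H x y).

Lemma dotE x : '[x, x] = (nrm x ^+ 2)%:C.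
Proof. by rewrite -hs_normE normE rmorphXn. Qed.

Lemma sqr_nrm x : nrm x ^+ 2 = complex.Re '[x, x].
Proof. by rewrite dotE. Qed.

Lemma dotC x y : '[x, y] = ('[y, x])^*%C.
Proof. by rewrite hermC /= expr0 mul1r. Qed.

Lemma dotDl x y z : '[x + y, z] = '[x, z] + '[y, z].
Proof. exact: linearDl. Qed.
Lemma dotDr x y z : '[z, x + y] = '[z, x] + '[z, y].
Proof. exact: linearDr. Qed.
Lemma dotBl x y z : '[x - y, z] = '[x, z] - '[y, z].
Proof. exact: linearBl. Qed.
Lemma dotBr x y z : '[z, x - y] = '[z, x] - '[z, y].
Proof. exact: linearBr. Qed.
Lemma dotZl c x y : '[c *: x, y] = c * '[x, y].
Proof. exact: linearZl_LR. Qed.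
Lemma dotZr c x y : '[x, c *: y] = c^*%C * '[x, y].
Proof. exact: linearZr_LR. Qed.
Lemma dot0l x : '[0, x] = 0.
Proof. exact: linear0l. Qed.
Lemma dot0r x : '[x, 0] = 0.
Proof. exact: linear0r. Qed.

Lemma dot_eq0C x y : '[x, y] = 0 -> '[y, x] = 0.
Proof. by rewrite dotC => /eqP; rewrite conjc_eq0 => /eqP. Qed.

Lemma dot_injr u v : (forall x, '[x, u] = '[x, v]) -> u = v.
Proof.
move=> h; apply/eqP; rewrite -subr_eq0; apply/eqP/nrm0_eq0.
have : '[u - v, u - v] = 0 by rewrite dotBr h subrr.
by rewrite dotE => /eqP; rewrite fmorph_eq0 sqrf_eq0 => /eqP.
Qed.

Lemma pythagoras x y : '[x, y] = 0 ->
  nrm (x + y) ^+ 2 = nrm x ^+ 2 + nrm y ^+ 2.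
Proof.
move=> xy; rewrite !sqr_nrm dotDl !dotDr xy (dot_eq0C xy) addr0 add0r.
exact: raddfD.
Qed.

Lemma parallelogram x y :
  nrm (x + y) ^+ 2 + nrm (x - y) ^+ 2 = 2 * nrm x ^+ 2 + 2 * nrm y ^+ 2.
Proof.
rewrite !sqr_nrm !dotBl !dotBr !dotDl !dotDr.
case: '[x, x] '[x, y] '[y, x] '[y, y] => [a b] [c d] [e f] [g h] /=; ring.
Qed.

(** Pythagoras for the splitting of [x] along [y]. It yields both Cauchy-Schwarz and the
    orthogonality of a nearest-point residual. *)
Lemma nrm_sub_component x y : y != 0 ->
  nrm (x - ('[x, y] / '[y, y]) *: y) ^+ 2 =
  nrm x ^+ 2 - nrm '[x, y] ^+ 2 / nrm y ^+ 2.
Proof.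
move=> y0; have ny0 : nrm y != 0 by apply: contra_neq y0 => /nrm0_eq0.
have dy0 : '[y, y] != 0 by rewrite dotE fmorph_eq0 sqrf_eq0.
set c := '[x, y] / '[y, y].
have o : '[x - c *: y, c *: y] = 0.
  by rewrite dotZr dotBl dotZl divfK // subrr mulr0.
have := pythagoras o; rewrite subrK => ->.
have -> : nrm (c *: y) = nrm '[x, y] / nrm y.
  rewrite nrmZ; have : nrm c * nrm '[y, y] = nrm '[x, y] by rewrite -nrmM divfK.
  rewrite {1}dotE nrmC_real ?sqr_ge0 // => <-; by field.
by rewrite expr_div_n addrK.
Qed.

Lemma dot_CauchySchwarz x y : nrm '[x, y] <= nrm x * nrm y.
Proof.
have [->|y0] := eqVneq y 0; first by rewrite dot0r !nrm0 mulr0.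
have ny : 0 < nrm y.
  by rewrite lt_neqAle nrm_ge0 andbT eq_sym; apply: contra_neq y0 => /nrm0_eq0.
have := sqr_ge0 (nrm (x - ('[x, y] / '[y, y]) *: y)).
rewrite nrm_sub_component // subr_ge0 ler_pdivrMr ?exprn_gt0 // -exprMn.
by rewrite ler_sqr ?nnegrE ?mulr_ge0 ?nrm_ge0.
Qed.

End InnerProduct.

(** * Bounded operators and closed subspaces *)

Section BoundedOperators.
Variables (R : realType).
Implicit Types (V W X : normedModType R[i]).

(** A predicate on bare functions, so that projections, adjoints and composites need no bundled
    linear structure. *)
Definition bounded_operator V W (T : V -> W) :=
  (forall (c : R[i]) x y, T (c *: x + y) = c *: T x + T y) /\
  exists r : R, forall x, nrm (T x) <= r * nrm x.

Section Theory.
Variables (V W : normedModType R[i]) (T : V -> W).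
Hypothesis bT : bounded_operator T.

Lemma bop_bound : exists2 r : R, 0 < r & forall x, nrm (T x) <= r * nrm x.
Proof.
have [_ [r hr]] := bT; exists (`|r| + 1); first by rewrite ltr_wpDl.
move=> x; apply: le_trans (hr x) _; rewrite ler_wpM2r ?nrm_ge0 //.
by rewrite (le_trans (ler_norm _)) // lerDl.
Qed.

Lemma bop0 : T 0 = 0.
Proof.
have := bT.1 1 0 0; rewrite !scale1r addr0 => /eqP.
by rewrite -subr_eq0 opprD addNKr oppr_eq0 => /eqP.
Qed.

Lemma bopD x y : T (x + y) = T x + T y.
Proof. by have := bT.1 1 x y; rewrite !scale1r. Qed.

Lemma bopZ c x : T (c *: x) = c *: T x.
Proof. by have := bT.1 c x 0; rewrite !addr0 bop0 addr0. Qed.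

Lemma bopN x : T (- x) = - T x.
Proof. by rewrite -scaleN1r bopZ scaleN1r. Qed.

Lemma bopB x y : T (x - y) = T x - T y.
Proof. by rewrite bopD bopN. Qed.

End Theory.

Lemma bop_comp V W X (T : W -> X) (U : V -> W) :
  bounded_operator T -> bounded_operator U -> bounded_operator (T \o U).
Proof.
move=> bT bU; split=> [c x y|]; first by rewrite /= bU.1 bT.1.
have [r r0 hr] := bop_bound bT; have [s s0 hs] := bop_bound bU.
exists (r * s) => x /=; apply: le_trans (hr _) _.
by rewrite -mulrA ler_wpM2l // ltW.
Qed.

Lemma bop_lin V W (c : R[i]) (T U : V -> W) :
  bounded_operator T -> bounded_operator U ->
  bounded_operator (fun x => c *: T x + U x).
Proof.
move=> bT bU; split=> [d x y|].
  by rewrite bT.1 bU.1 !scalerDr !scalerA addrACA mulrC.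
have [r r0 hr] := bop_bound bT; have [s s0 hs] := bop_bound bU.
exists (nrm c * r + s) => x; apply: le_trans (ler_nrmD _ _) _.
by rewrite nrmZ mulrDl lerD // -mulrA ler_wpM2l ?nrm_ge0.
Qed.

Lemma bop_id V : bounded_operator (@id V).
Proof. by split=> //; exists 1 => x; rewrite mul1r. Qed.

Lemma bop_zero V W : bounded_operator (fun _ : V => 0 : W).
Proof.
by split=> [c x y|]; rewrite ?scaler0 ?addr0 //; exists 0 => x; rewrite nrm0 mul0r.
Qed.

Lemma bop_sub V W (T U : V -> W) :
  bounded_operator T -> bounded_operator U ->
  bounded_operator (fun x => T x - U x).
Proof.
move=> bT bU; have := bop_lin (-1) bU bT.
by congr bounded_operator; apply/funext => x; rewrite scaleN1r addrC.
Qed.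

Lemma bop_sum V W (I : Type) (s : seq I) (T : I -> V -> W) :
  (forall i, bounded_operator (T i)) ->
  bounded_operator (fun x => \sum_(i <- s) T i x).
Proof.
move=> bT; elim: s => [|i s IH].
  by under eq_fun do rewrite big_nil; exact: bop_zero.
under eq_fun do rewrite big_cons -[T i _]scale1r; exact: bop_lin.
Qed.

Lemma continuous_bop V W (T : {linear V -> W}) :
  continuous T -> bounded_operator T.
Proof.
move=> /linear_bounded_continuous/linear_boundedP[r [rr hr]].
split=> [c x y|]; first by rewrite linearP.
have rE := real_complexE rr.
exists (complex.Re r + 1) => x; rewrite -lecR rmorphM /= -!normE.
by apply: hr; rewrite rE ltcR ltrDl.
Qed.

End BoundedOperators.

Section ClosedSubspaces.
Variables (R : realType).
Implicit Types (H : hilbertSpace R).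

Lemma closed_nrm H (A : set H) :
  (forall x, (forall e : R, 0 < e -> exists2 y, A y & nrm (x - y) < e) -> A x) ->
  closed A.
Proof.
move=> h; rewrite closure_id; apply/seteqP; split; first exact: subset_closure.
by move=> x /closure_nrm; exact: h.
Qed.

Lemma closed_nrm_mem H (A : set H) x : closed A ->
  (forall e : R, 0 < e -> exists2 y, A y & nrm (x - y) < e) -> A x.
Proof. by move=> /closure_id AE /closure_nrm; rewrite -AE. Qed.

Section Theory.
Variables (H : hilbertSpace R) (S : set H).
Hypothesis cS : closed_subspace S.

Lemma csub0 : S 0. Proof. by case: cS. Qed.

Lemma csubD x y : S x -> S y -> S (x + y).
Proof. by case: cS => _ _ h Sx Sy; rewrite -[x]scale1r; exact: h. Qed.

Lemma csubZ c x : S x -> S (c *: x).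
Proof. by case: cS => _ S0 h Sx; rewrite -[_ *: _]addr0; exact: h. Qed.

Lemma csubB x y : S x -> S y -> S (x - y).
Proof. by move=> Sx Sy; rewrite -scaleN1r; apply: csubD => //; exact: csubZ. Qed.

End Theory.

Lemma csub_preimage H1 H2 (T : H1 -> H2) (S : set H2) :
  bounded_operator T -> closed_subspace S -> closed_subspace [set x | S (T x)].
Proof.
move=> bT cS; split=> [||c x y /= Sx Sy].
- apply: closed_nrm => x hx; case: (cS) => Sc _ _.
  apply: (closed_nrm_mem Sc) => e e0; have [r r0 hr] := bop_bound bT.
  have [|y /= Sy xy] := hx (e / r); first exact: divr_gt0.
  exists (T y) => //; rewrite -(bopB bT); apply: le_lt_trans (hr _) _.
  by rewrite mulrC -ltr_pdivlMr.
- by rewrite /= (bop0 bT); exact: csub0 cS.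
- by rewrite /= bT.1; case: (cS) => _ _; apply.
Qed.

Lemma csub_smallest H (A : set H) : closed_subspace (smallest (@closed_subspace R H) A).
Proof.
split=> [||c x y Sx Sy].
- by apply: closed_bigI => B /= [[]].
- by move=> B [cB _]; exact: csub0 cB.
- by move=> B BA; have [cB _] := BA; case: (cB) => _ _; apply; [exact: Sx|exact: Sy].
Qed.

Lemma csub_ker H (f : H -> R[i]) (r : R) :
  (forall c x y, f (c *: x + y) = c * f x + f y) ->
  (forall x, nrm (f x) <= r * nrm x) -> closed_subspace [set x | f x = 0].
Proof.
move=> fP fr.
have f0 : f 0 = 0.
  apply: nrm0_eq0; apply/le_anti; rewrite nrm_ge0 andbT.
  by rewrite (le_trans (fr 0)) // nrm0 mulr0.
split=> [||c u v /= hu hv]; last by rewrite /= fP hu hv mulr0 addr0.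
- apply: closed_nrm => x hx; apply/nrm0_eq0/le_anti; rewrite nrm_ge0 andbT.
  apply/ler_addgt0Pl => e e0; rewrite addr0.
  have r1 : 0 < `|r| + 1 by rewrite ltr_wpDl.
  have [|z /= zy] := hx (e / (`|r| + 1)); first by rewrite divr_gt0.
  rewrite ltr_pdivlMr // => xz.
  have -> : f x = f (x - z).
    by rewrite addrC -scaleN1r fP zy mulr0 add0r.
  apply: le_trans (fr _) _; apply: le_trans (ltW xz).
  rewrite mulrC ler_wpM2l ?nrm_ge0 //.
  by rewrite (le_trans (ler_norm _)) // lerDl.
- by [].
Qed.

Lemma csub_orth H (y : H) : closed_subspace [set x | hs_dot H x y = 0].
Proof.
apply: (@csub_ker _ _ (nrm y)) => [c u v|u]; first by rewrite dotDl dotZl.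
by rewrite mulrC dot_CauchySchwarz.
Qed.

Lemma csub_zero H : closed_subspace [set 0 : H].
Proof.
split=> [||c x y /= -> ->]; last by rewrite /= scaler0 addr0.
- apply: closed_nrm => x hx; apply/nrm0_eq0/le_anti; rewrite nrm_ge0 andbT.
  apply/ler_addgt0Pl => e e0; rewrite addr0.
  by have [_ /= -> /ltW] := hx e e0; rewrite subr0.
- by [].
Qed.

(** Makes the equality of two bounded operators a closed linear condition, which can then be checked
    on a spanning family. *)
Lemma csub_eq H1 H2 (T U : H1 -> H2) : bounded_operator T -> bounded_operator U ->
  closed_subspace [set x | T x = U x].
Proof.
move=> bT bU; have := csub_preimage (bop_sub bT bU) (csub_zero H2).
congr closed_subspace; apply/funext => x /=; apply/propext.
by split=> [/eqP|->]; rewrite ?subrr // subr_eq0 => /eqP.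
Qed.

End ClosedSubspaces.

(** * Projections and adjoints *)

Section Projection.
Variables (R : realType) (H : hilbertSpace R).
Implicit Types (x y z p s : H) (S : set H).

Local Notation "''[' x , y ]" := (hs_dot H x y).

(* A minimizing filter for the distance from x to S is Cauchy by the parallelogram law. *)
Lemma nearest_point S x : closed_subspace S ->
  exists2 p, S p & forall q, S q -> nrm (x - p) <= nrm (x - q).
Proof.
move=> cS; have [cl S0 _] := cS.
pose D := [set nrm (x - y) ^+ 2 | y in S].
have Dlb : lbound D 0 by move=> _ [y _ <-]; exact: sqr_ge0.
have infD : has_inf D by split; [exists (nrm (x - 0) ^+ 2), 0|exists 0].
set d := inf D.
have dle y : S y -> d <= nrm (x - y) ^+ 2.
  by move=> Sy; apply: ge_inf; [exists 0|exists y].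
have d0 : 0 <= d by apply: lb_le_inf => //; case: infD.
pose A (e : R) := [set y | S y /\ nrm (x - y) ^+ 2 < d + e].
have A0 e : 0 < e -> A e !=set0.
  by move=> e0; have [_ [y Sy <-] ye] := inf_adherent e0 infD; exists y.
(* The midpoint of [y] and [z] lies in [S], hence at squared distance at least [d] from [x]; the
   parallelogram law leaves at most [4 * (d + e) - 4 * d]. *)
have Aclose e y z : A e y -> A e z -> nrm (y - z) ^+ 2 <= 4 * e.
  move=> [Sy ye] [Sz ze].
  have := parallelogram (x - y) (x - z).
  have -> : x - y - (x - z) = - (y - z) by rewrite opprB addrC addrA subrK opprB.
  have Sm : S (2^-1 *: (y + z)) by apply: (csubZ cS); exact: csubD.
  have -> : (x - y) + (x - z) = 2 *: (x - 2^-1 *: (y + z)).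
    rewrite scalerBr scalerA mulfV ?scale1r ?pnatr_eq0 //.
    by rewrite addrACA -opprD scaler_nat mulr2n.
  have n2 : nrm (2 : R[i]) = 2 by have := nrmC_real (ler0n R 2); rewrite rmorph_nat.
  rewrite nrmZ n2 exprMn nrmN => par.
  have := dle _ Sm; lra.
pose F := filter_from [set e : R | 0 < e] A.
have FF : ProperFilter F.
  apply: filter_from_proper; last by move=> e /A0.
  apply: filter_from_filter; first by exists 1; exact: ltr01.
  move=> e f /= e0 f0; exists (Num.min e f); first by rewrite /= lt_min e0.
  move=> y [Sy ye]; split; split => //; apply: lt_le_trans ye _;
    by rewrite lerD2l ge_min lexx ?orbT.
have cF : cvg F.
  apply: cauchy_nrm => e e0.
  (* With this tolerance [Aclose] bounds squared distances by [e ^+ 2 / 2]. *)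
  have e8 : 0 < e ^+ 2 / 8 by rewrite divr_gt0 ?exprn_gt0.
  have [y Ay] := A0 _ e8; exists y; exists (e ^+ 2 / 8) => // z Az.
  rewrite /= -ltr_sqr ?nnegrE ?nrm_ge0 ?ltW //.
  have := Aclose _ _ _ Ay Az; have := exprn_gt0 2 e0; lra.
set p := lim F.
have near (e : R) : 0 < e -> exists2 y, A e y & nrm (p - y) < e.
  move=> e0; have Fp : F [set y | nrm (p - y) < e].
    by apply: cF; apply/nbhs_nrm; exists e.
  have FA : F (A e) by exists e.
  by have [y [yp yA]] := filter_ex (filterI Fp FA); exists y.
exists p.
  by apply: (closed_nrm_mem cl) => e /near[y [Sy _] yp]; exists y.
suff pd : nrm (x - p) ^+ 2 <= d.
  move=> q Sq; rewrite -ler_sqr ?nnegrE ?nrm_ge0 //.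
  exact: le_trans pd (dle _ Sq).
rewrite leNgt; apply/negP => dp; set a := nrm (x - p) in dp.
have a0 : 0 < a.
  rewrite lt_neqAle nrm_ge0 andbT; apply/eqP => a0.
  by move: dp; rewrite -a0 expr0n /= ltNge d0.
(* A point [y] of [A e] within [e] of [p] gives [(a - e) ^+ 2 < d + e], which contradicts
   [e * (2 * a + 1) <= a ^+ 2 - d]. The bound [e <= a] allows the comparison of squares. *)
pose e := Num.min a ((a ^+ 2 - d) / (2 * a + 1)).
have a1 : 0 < 2 * a + 1 by rewrite addr_gt0 // mulr_gt0.
have e0 : 0 < e by rewrite lt_min a0 divr_gt0 // subr_gt0.
have [y [_ ye] yp] := near e e0.
have ea : e <= a by rewrite ge_min lexx.
have /[!ler_pdivlMr]// eb : e <= (a ^+ 2 - d) / (2 * a + 1).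
  by rewrite ge_min lexx orbT.
have : (a - e) ^+ 2 <= nrm (x - y) ^+ 2.
  rewrite ler_sqr ?nnegrE ?nrm_ge0 ?subr_ge0 // lerBlDr.
  apply: le_trans (ler_nrmB3 x y p) _; rewrite lerD2l nrmBC; exact: ltW.
have := sqr_ge0 e; rewrite sqrrB; nra.
Qed.

(** [xget] needs a default value, here [0]; [projP] shows that it is never resorted to when [S] is a
    closed subspace. *)
Definition proj S x : H :=
  xget 0 [set p | S p /\ forall s, S s -> '[x - p, s] = 0].

Section Theory.
Variable S : set H.
Hypothesis cS : closed_subspace S.

(** For a nearest point [p], removing from [x - p] its component along [s] would lower the norm
    unless [x - p] is orthogonal to [s]. *)
Lemma projP x : S (proj S x) /\ forall s, S s -> '[x - proj S x, s] = 0.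
Proof.
rewrite /proj; case: xgetP => [p _ //|no].
have [p Sp pmin] := nearest_point x cS.
case: (no p); split=> // s Ss; have [->|s0] := eqVneq s 0; first exact: dot0r.
apply: nrm0_eq0; apply/eqP; rewrite -(sqrf_eq0 (nrm _)); apply/eqP/le_anti.
rewrite sqr_ge0 andbT.
have ns0 : 0 < nrm s.
  rewrite lt_neqAle nrm_ge0 andbT; apply/eqP => /esym/nrm0_eq0.
  exact/eqP.
have := pmin _ (csubD cS Sp (csubZ cS ('[x - p, s] / '[s, s]) Ss)).
rewrite opprD addrA -ler_sqr ?nnegrE ?nrm_ge0 // nrm_sub_component //.
by rewrite lerBrDr gerDl ler_pdivrMr ?exprn_gt0 // mul0r.
Qed.

Lemma proj_in x : S (proj S x). Proof. exact: (projP x).1. Qed.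

Lemma proj_orth x s : S s -> '[x - proj S x, s] = 0.
Proof. exact: (projP x).2. Qed.

Lemma proj_uniq x p : S p -> (forall s, S s -> '[x - p, s] = 0) -> proj S x = p.
Proof.
move=> Sp hp; apply/eqP; rewrite -subr_eq0; apply/eqP/nrm0_eq0/eqP.
set q := proj S x - p.
have Sq : S q by apply: (csubB cS) => //; exact: proj_in.
have : '[q, q] = 0.
  have := hp _ Sq; rewrite -(subrKA (proj S x)) dotDl proj_orth // add0r.
  by [].
by rewrite dotE => /eqP; rewrite fmorph_eq0 sqrf_eq0.
Qed.

Lemma proj_id x : S x -> proj S x = x.
Proof. by move=> Sx; apply: proj_uniq => // s _; rewrite subrr dot0l. Qed.

Lemma proj_dot x y : '[proj S x, y] = '[x, proj S y].
Proof.
have h u v : '[proj S u, v] = '[proj S u, proj S v].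
  apply/eqP; rewrite -subr_eq0 -dotBr; apply/eqP/dot_eq0C.
  by apply: proj_orth; exact: proj_in.
by rewrite (h x) [RHS]dotC (h y) -dotC.
Qed.

Lemma bop_proj : bounded_operator (proj S).
Proof.
split=> [c x y|].
  apply: proj_uniq => [|s Ss].
    by case: (cS) => _ _; apply; exact: proj_in.
  rewrite opprD addrACA -scalerBr dotDl dotZl !proj_orth //.
  by rewrite mulr0 addr0.
exists 1 => x; rewrite mul1r -ler_sqr ?nnegrE ?nrm_ge0 //.
have o : '[x - proj S x, proj S x] = 0 by apply: proj_orth; exact: proj_in.
by have := pythagoras o; rewrite subrK => ->; rewrite lerDr sqr_ge0.
Qed.

End Theory.
End Projection.

Section Adjoint.
Variables (R : realType).
Implicit Types (H : hilbertSpace R).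

(** Unless [f] vanishes, some [z] orthogonal to its kernel has [f z] nonzero. Then
    [x - (f x / f z) *: z] is in the kernel, so [f x] is proportional to the inner product of [x]
    with [z]. *)
Lemma riesz H (f : H -> R[i]) (r : R) :
  (forall c x y, f (c *: x + y) = c * f x + f y) ->
  (forall x, nrm (f x) <= r * nrm x) ->
  exists z, forall x, f x = hs_dot H x z.
Proof.
move=> fP fr; have cK := csub_ker fP fr; set K := [set x | f x = 0] in cK.
have fB x y : f (x - y) = f x - f y.
  by rewrite addrC -scaleN1r fP mulN1r addrC.
have fZ c x : f (c *: x) = c * f x.
  by have := fP c x 0; rewrite !addr0 (csub0 cK : f 0 = 0) addr0.
have [[x0 /eqP fx0]|f0] := pselect (exists x, f x <> 0); last first.
  exists 0 => x; rewrite dot0r.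
  by apply: contrapT => fx; apply: f0; exists x.
pose z := x0 - proj K x0.
have fz : f z = f x0 by rewrite fB (proj_in cK x0 : f _ = 0) subr0.
have z0 : hs_dot H z z != 0.
  rewrite dotE fmorph_eq0 sqrf_eq0; apply/eqP => /nrm0_eq0 z0.
  by move: fx0; rewrite -fz z0 (csub0 cK : f 0 = 0) eqxx.
(* The form is conjugate-linear in its second argument, hence the conjugated scalar. *)
exists ((f z / hs_dot H z z)^*%C *: z) => x; rewrite dotZr conjcK.
have Kx : K (x - (f x / f z) *: z) by rewrite /K /= fB fZ divfK ?fz // subrr.
have := dot_eq0C (proj_orth cK x0 Kx); rewrite dotBl dotZl.
rewrite -/z => /eqP; rewrite subr_eq0 => /eqP ->; field.
by rewrite z0 fz fx0.
Qed.

Definition adj H1 H2 (T : H1 -> H2) (y : H2) : H1 :=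
  xget 0 [set z | forall x, hs_dot H2 (T x) y = hs_dot H1 x z].

Section Theory.
Variables (H1 H2 : hilbertSpace R) (T : H1 -> H2).
Hypothesis bT : bounded_operator T.

Lemma adjP x y : hs_dot H2 (T x) y = hs_dot H1 x (adj T y).
Proof.
rewrite /adj; case: xgetP => [z _ /(_ x) //|no].
have [r r0 hr] := bop_bound bT.
have [|u|z hz] := @riesz H1 (fun x => hs_dot H2 (T x) y) (r * nrm y).
- by move=> c u v; rewrite bT.1 dotDl dotZl.
- apply: le_trans (dot_CauchySchwarz _ _) _.
  by rewrite mulrAC ler_wpM2r ?nrm_ge0.
by case: (no z).
Qed.

Lemma adjPl x y : hs_dot H1 (adj T y) x = hs_dot H2 y (T x).
Proof. by rewrite dotC -adjP -dotC. Qed.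

Lemma adj_uniq (A : H2 -> H1) :
  (forall x y, hs_dot H2 (T x) y = hs_dot H1 x (A y)) -> A = adj T.
Proof.
by move=> hA; apply/funext => y; apply: dot_injr => x; rewrite -hA adjP.
Qed.

Lemma bop_adj : bounded_operator (adj T).
Proof.
split=> [c x y|].
  by apply: dot_injr => z; rewrite -adjP !dotDr !dotZr -!adjP.
have [r r0 hr] := bop_bound bT; exists r => y.
have [->|n0] := eqVneq (nrm (adj T y)) 0; first by rewrite mulr_ge0 ?nrm_ge0 ?ltW.
have np : 0 < nrm (adj T y) by rewrite lt_neqAle eq_sym n0 nrm_ge0.
(* Multiplying by [nrm (adj T y)] makes the left side a square, which is the real part of the inner
   product of [T (adj T y)] with [y]. *)
rewrite -(ler_pM2r np) -expr2 sqr_nrm -adjP.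
apply: le_trans (ler_Re_nrm _) _; apply: le_trans (dot_CauchySchwarz _ _) _.
by rewrite mulrAC ler_wpM2r ?nrm_ge0.
Qed.

End Theory.
End Adjoint.

(** * Compact operators *)

Section CompactOperators.
Variables (R : realType).
Implicit Types (H : hilbertSpace R).

(* Total boundedness of the images of balls, in terms of finite colourings of
   the source: this form involves no choice of centres in the target, so it is
   inherited by T from adj T \o T. *)
Definition compact_operator H1 H2 (T : H1 -> H2) :=
  forall r e : R, 0 < e -> exists (C : finType) (col : H1 -> C),
    forall x y, nrm x <= r -> nrm y <= r -> col x = col y -> nrm (T x - T y) < e.

Lemma compact_zero H1 H2 : compact_operator (fun _ : H1 => 0 : H2).
Proof.
move=> r e e0; exists unit, (fun=> tt) => x y _ _ _.
by rewrite subr0 nrm0.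
Qed.

Lemma compact_add H1 H2 (T U : H1 -> H2) :
  compact_operator T -> compact_operator U ->
  compact_operator (fun x => T x + U x).
Proof.
move=> cT cU r e e0; have e2 : 0 < e / 2 by rewrite divr_gt0.
have [C [col hcol]] := cT r _ e2; have [D [dol hdol]] := cU r _ e2.
exists (C * D)%type, (fun x => (col x, dol x)) => x y hx hy [cxy dxy].
rewrite opprD addrACA; apply: le_lt_trans (ler_nrmD _ _) _.
by rewrite [e]splitr ltrD ?hcol ?hdol.
Qed.

Lemma compact_compl H1 H2 H3 (B : H2 -> H3) (T : H1 -> H2) :
  bounded_operator B -> compact_operator T -> compact_operator (B \o T).
Proof.
move=> bB cT r e e0; have [s s0 hs] := bop_bound bB.
have [|C [col hcol]] := cT r (e / s); first by rewrite divr_gt0.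
exists C, col => x y hx hy cxy; rewrite /= -(bopB bB).
by apply: le_lt_trans (hs _) _; rewrite mulrC -ltr_pdivlMr // hcol.
Qed.

Lemma compact_compr H1 H2 H3 (T : H2 -> H3) (B : H1 -> H2) :
  bounded_operator B -> compact_operator T -> compact_operator (T \o B).
Proof.
move=> bB cT r e e0; have [s s0 hs] := bop_bound bB.
have [C [col hcol]] := cT (s * r) e e0.
exists C, (col \o B) => x y hx hy cxy; apply: hcol cxy;
  by rewrite (le_trans (hs _)) // ler_wpM2l // ltW.
Qed.

Lemma compact_scale H1 H2 (c : R[i]) (T : H1 -> H2) :
  compact_operator T -> compact_operator (fun x => c *: T x).
Proof.
apply: (@compact_compl _ _ _ (fun y => c *: y)).
have := bop_lin c (bop_id H2) (bop_zero H2 H2).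
by congr bounded_operator; apply/funext => x; rewrite addr0.
Qed.

Lemma compact_sum H1 H2 (I : Type) (s : seq I) (T : I -> H1 -> H2) :
  (forall i, compact_operator (T i)) ->
  compact_operator (fun x => \sum_(i <- s) T i x).
Proof.
move=> cT; elim: s => [|i s IH].
  by under eq_fun do rewrite big_nil; exact: compact_zero.
by under eq_fun do rewrite big_cons; exact: compact_add.
Qed.

(** For [u = x - y], [nrm (T u) ^+ 2] is the real part of the inner product of [u] with
    [adj T (T u)], so a fine enough colouring for [adj T \o T] also serves [T]. *)
Lemma compact_of_adj_comp H1 H2 (T : H1 -> H2) : bounded_operator T ->
  compact_operator (adj T \o T) -> compact_operator T.
Proof.
(* [r1] bounds the distance between two points of the ball of radius [r], and is positive whatever
   the sign of [r]. *)
move=> bT cT r e e0; pose r1 := 2 * (`|r| + 1).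
have r10 : 0 < r1 by rewrite mulr_gt0 // ltr_wpDl.
have [|C [col hcol]] := cT r (e ^+ 2 / r1).
  by rewrite divr_gt0 ?exprn_gt0.
exists C, col => x y hx hy /hcol => /(_ hx hy) /=.
rewrite -(bopB (bop_adj bT)) -(bopB bT) ltr_pdivlMr // => h.
rewrite -ltr_sqr ?nnegrE ?nrm_ge0 ?ltW //; apply: le_lt_trans h.
rewrite sqr_nrm (adjP bT); set z := adj T _.
have xy : nrm (x - y) <= r1.
  apply: le_trans (ler_nrmD _ _) _; rewrite nrmN /r1.
  have := ler_norm r; lra.
apply: le_trans (ler_Re_nrm _) _; apply: le_trans (dot_CauchySchwarz _ _) _.
by rewrite mulrC ler_wpM2l // nrm_ge0.
Qed.

(** A finite cover of the compact closure by small balls provides the colours: a vector is coloured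
    by a ball containing the image of its rescaling into the unit ball. *)
Lemma compact_on_setT H1 (T : H1 -> H1) : bounded_operator T ->
  compact_on setT T -> compact_operator T.
Proof.
move=> bT; rewrite /compact_on precompactE compact_cover => cT r e e0.
pose s := `|r| + 1; have s0 : 0 < s by rewrite ltr_wpDl.
have s0' : 0 <= s^-1 by rewrite invr_ge0 ltW.
(* Two images in one ball are less than [e / s] apart; undoing the rescaling by [s] gives [e]. *)
pose e' := e / s / 2; have e'0 : 0 < e' by rewrite !divr_gt0.
pose B (y : H1) := interior [set z | nrm (y - z) < e'].
have [||D _ hD] := cT _ setT B.
- by move=> y _; exact: open_interior.
- by move=> y _; exists y => //; apply/nbhs_nrm; exists e'.
pose near (x : H1) (y : D) := `[< nrm (val y - T (s^-1%:C *: x)) < e' >].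
exists (option D), (fun x => [pick y | near x y]).
have key x : nrm x <= r -> exists y : D, near x y.
  move=> xr.
  have /subset_closure/hD[y yD By] :
      (T @` [set x | setT x /\ `|x| <= 1]) (T (s^-1%:C *: x)).
    exists (s^-1%:C *: x) => //; split=> //.
    rewrite norm_le1 nrmZ nrmC_real // ler_pdivrMl //.
    by rewrite mulr1 (le_trans xr) // (le_trans (ler_norm _)) // lerDl.
  by exists [` yD]%fset; apply/asboolP; exact: (interior_subset By).
move=> x y xr yr.
case: pickP => [u /asboolP hx|no]; last by have [u] := key x xr; rewrite no.
case: pickP => [v /asboolP hy|no]; last by have [v] := key y yr; rewrite no.
case=> uv; rewrite -{v}uv in hy.
have lt2 : nrm (T (s^-1%:C *: x) - T (s^-1%:C *: y)) < e / s.
  apply: le_lt_trans (ler_nrmB3 _ (val u) _) _.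
  by rewrite [ltRHS]splitr ltrD // nrmBC.
move: lt2; rewrite -(bopB bT) -scalerBr (bopZ bT) nrmZ nrmC_real //.
by rewrite mulrC ltr_pM2r ?invr_gt0 // (bopB bT).
Qed.

(** Total boundedness and completeness: an ultrafilter on the closure of the image contains a ball
    of every positive radius, so it is Cauchy and converges. *)
Lemma compact_onP H1 (S : set H1) (T U : H1 -> H1) :
  compact_operator T -> (forall x, S x -> U x = T x) -> compact_on S U.
Proof.
move=> cT UT; rewrite /compact_on; set A := _ @` _.
rewrite precompactE compact_ultra => G GU GA.
have cG : cvg G.
  apply: cauchy_nrm => e e0; have e2 : 0 < e / 2 by rewrite divr_gt0.
  have [C [col hcol]] := cT 1 _ e2.
  (* One vector per colour, sought in the whole unit ball rather than in [S]; a colour that does not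
     occur there gets the default [0]. *)
  pose rep c := xget 0 [set x : H1 | col x = c /\ nrm x <= 1].
  pose B c := [set z | nrm (T (rep c) - z) < e].
  apply: contrapT => no.
  have nB c : G (~` B c).
    have [GB|//] := in_ultra_setVsetC (B c) GU.
    by case: no; exists (T (rep c)).
  (* If [G] contained none of the finitely many balls, some [z] in the closure of [A] would avoid
     them all, although it is close to some [U x], hence to the image of the representative of the
     colour of [x]. *)
  have [z [zA zB]] := filter_ex (filterI GA (filter_forall _ nB)).
  have /closure_nrm/(_ _ e2)[_ [x [Sx x1] <-] zx] := zA.
  rewrite norm_le1 in x1.
  apply: (zB (col x)); rewrite /B /= nrmBC.
  have [rc r1] : [set y : H1 | col y = col x /\ nrm y <= 1] (rep (col x)).
    by apply: xgetPex; exists x.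
  apply: le_lt_trans (ler_nrmB3 _ (U x) _) _.
  by rewrite [e]splitr ltrD // UT // hcol.
exists (lim G); split; last exact: cG.
apply: (closed_nrm_mem (@closed_closure _ A)) => e e0.
have Ge : G [set y | nrm (lim G - y) < e] by apply: cG; apply/nbhs_nrm; exists e.
by have [y [? ?]] := filter_ex (filterI GA Ge); exists y.
Qed.

End CompactOperators.

(** * Hilbert modules *)

(** The variables generate the polynomial algebra, so a property of [hm_act] stable under linear
    combinations and products reduces to the coordinate operators. *)
Lemma mpoly_algebra_ind (m : nat) (K : comNzRingType) (P : mpoly m K -> Prop) :
  P 1 -> (forall i, P (mpolyX K (mnm1 i))) ->
  (forall (c : K) p q, P p -> P q -> P (c *: p + q)) ->
  (forall p q, P p -> P q -> P (p * q)) -> forall p, P p.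
Proof.
move=> P1 PX PD PM.
have P0 : P 0 by have := PD (-1) 1 1 P1 P1; rewrite scaleN1r addNr.
have Pm a : P (mpolyX K a).
  rewrite mpolyXE_id; apply: (big_ind P) => // i _.
  by elim: (a i) => [|n IH]; rewrite ?expr0 // exprS; exact: PM.
by apply: mpolyind => // c a p _ _ Pp; exact: PD.
Qed.

Section CompactCommutators.
Variables (R : realType) (H : hilbertSpace R).
Implicit Types (T U A : H -> H).

Lemma compact_commutatorC T A :
  compact_operator (commutator T A) -> compact_operator (commutator A T).
Proof.
move=> /(compact_scale (-1)); congr compact_operator; apply/funext => x.
by rewrite /commutator scaleN1r opprB.
Qed.

Lemma compact_commutator_lin c T U A : bounded_operator A ->
  compact_operator (commutator T A) -> compact_operator (commutator U A) ->
  compact_operator (commutator (fun x => c *: T x + U x) A).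
Proof.
move=> bA /(compact_scale c) cT /(compact_add cT).
congr compact_operator; apply/funext => x.
by rewrite /commutator bA.1 scalerBr opprD addrACA.
Qed.

(** Leibniz rule: [[T U, A] = T [U, A] + [T, A] U]. *)
Lemma compact_commutator_comp T U A : bounded_operator A ->
  bounded_operator T -> bounded_operator U ->
  compact_operator (commutator T A) -> compact_operator (commutator U A) ->
  compact_operator (commutator (T \o U) A).
Proof.
move=> bA bT bU /(compact_compr bU) cT /(compact_compl bT) cU.
have := compact_add cU cT; congr compact_operator; apply/funext => x.
by rewrite /commutator /= (bopB bT) addrA subrK.
Qed.

End CompactCommutators.

Section HilbertModules.
Variables (R : realType) (m : nat) (M : hilbertModule R m).
Implicit Types (p q : mpoly m R[i]).

Lemma bop_act p : bounded_operator (hm_act M p).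
Proof. by apply: continuous_bop; exact: hm_act_continuous. Qed.

Lemma bop_coord i : bounded_operator (@coord_op R m M i).
Proof. exact: bop_act. Qed.

Lemma adj_act1 : adj (hm_act M 1) = id.
Proof. by apply/esym/(adj_uniq (bop_act 1)) => x y; rewrite hm_act1. Qed.

Lemma adj_actM p q : adj (hm_act M (p * q)) = adj (hm_act M q) \o adj (hm_act M p).
Proof.
apply/esym/(adj_uniq (bop_act _)) => x y.
by rewrite hm_actM !(adjP (bop_act _)).
Qed.

Lemma adj_act_lin c p q : adj (hm_act M (c *: p + q)) =
  fun y => c^*%C *: adj (hm_act M p) y + adj (hm_act M q) y.
Proof.
apply/esym/(adj_uniq (bop_act _)) => x y.
by rewrite hm_actD hm_actZ dotDl dotZl dotDr dotZr conjcK !(adjP (bop_act _)).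
Qed.

(** Induction on [p] for all [q], and on [q] when [p] is a variable. On the [q] side the commutator
    is swapped, so that the rules for its first argument apply to adjoints. *)
Lemma compact_commutators :
  (forall i j, compact_operator (commutator (@coord_op R m M i) (adj (@coord_op R m M j)))) ->
  forall p q, compact_operator (commutator (hm_act M p) (adj (hm_act M q))).
Proof.
move=> cX p q; have bA r := bop_adj (bop_act r).
elim/mpoly_algebra_ind: p q => [q|i|c p1 p2 h1 h2 q|p1 p2 h1 h2 q].
- have := @compact_zero R M M; congr compact_operator; apply/funext => x.
  by rewrite /commutator !hm_act1 subrr.
- elim/mpoly_algebra_ind => [|j|c q1 q2 h1 h2|q1 q2 h1 h2].
  + have := @compact_zero R M M; congr compact_operator; apply/funext => x.
    by rewrite /commutator adj_act1 subrr.
  + exact: cX.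
  + rewrite adj_act_lin; apply: compact_commutatorC.
    by apply: compact_commutator_lin; [exact: bop_act|exact: compact_commutatorC..].
  + rewrite adj_actM; apply: compact_commutatorC.
    by apply: compact_commutator_comp => //; [exact: bop_act|exact: compact_commutatorC..].
- have -> : hm_act M (c *: p1 + p2) = (fun x => c *: hm_act M p1 x + hm_act M p2 x) :> (_ -> _).
    by apply/funext => x; rewrite hm_actD hm_actZ.
  exact: compact_commutator_lin.
- have -> : hm_act M (p1 * p2) = hm_act M p1 \o hm_act M p2 :> (_ -> _).
    by apply/funext => x; rewrite hm_actM.
  by apply: compact_commutator_comp => //; exact: bop_act.
Qed.

(** * Compression to a submodule *)

Section Compression.
Variable S : set M.
Hypothesis cS : closed_subspace S.

Let Q (x : M) := x - proj S x.

Let bQ : bounded_operator Q.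
Proof. by apply: bop_sub; [exact: bop_id|exact: bop_proj]. Qed.

(** For a product, insert [P + Q = 1] between the adjoints, [P] being the projection: [Q q^* p^* P =
    (Q q^* P) p^* P + Q q^* (Q p^* P)]. *)
Lemma compact_off_corner :
  (forall j, compact_operator (Q \o adj (@coord_op R m M j) \o proj S)) ->
  forall p, compact_operator (Q \o adj (hm_act M p) \o proj S).
Proof.
move=> cX; elim/mpoly_algebra_ind => [||c p q hp hq|p q hp hq].
- have := @compact_zero R M M; congr compact_operator; apply/funext => x.
  by rewrite /= adj_act1 /Q (proj_id cS (proj_in cS x)) subrr.
- exact: cX.
- have := compact_add (compact_scale (c^*%C) hp) hq; congr compact_operator.
  by apply/funext => x; rewrite adj_act_lin /= bQ.1.
- have bq := bop_adj (bop_act q); have bp := bop_adj (bop_act p).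
  have := compact_add (compact_compr (bop_comp bp (bop_proj cS)) hq)
                      (compact_compl (bop_comp bQ bq) hp).
  congr compact_operator; apply/funext => x; rewrite adj_actM /=.
  by rewrite -(bopD bQ) -(bopD bq) addrC subrK.
Qed.

(* With B the adjoint of p on M and P the projection on S, the adjoint of p on S
   is P B, and P B p - p P B = P [B, p] + P p (1 - P) B on S. *)
Lemma essentially_reductive_compression : submodule S ->
  (forall i j, compact_operator (commutator (@coord_op R m M i) (adj (@coord_op R m M j)))) ->
  (forall j, compact_operator (Q \o adj (@coord_op R m M j) \o proj S)) ->
  essentially_reductive S.
Proof.
move=> [_ Sact] cX cQ p; have bp := bop_act p; have bP := bop_proj cS.
exists (proj S \o adj (hm_act M p)); split.
  split=> [x _|x y Sx Sy]; first exact: (proj_in cS).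
  by rewrite /= -(proj_dot cS) (proj_id cS) // (adjP bp).
have cB := compact_commutatorC (compact_commutators cX p p).
have := compact_add (compact_compl bP cB)
  (compact_compl (bop_comp bP bp) (compact_off_corner cQ p)).
move/compact_onP; apply => x Sx; rewrite /commutator /= (proj_id cS Sx) /Q.
rewrite !(bopB bP) !(bopB bp) !(bopB bP) addrA subrK; congr (_ - _).
have Sy : S (proj S (adj (hm_act M p) x)) by exact: proj_in.
by rewrite [proj S (hm_act M p (proj S _))](proj_id cS) //; exact: Sact.
Qed.

End Compression.
End HilbertModules.

(** * Weighted modules *)

Section Amplification.
Variables (R : realType) (m : nat) (L : multinom m -> R).
Variables (M : weightedModule L) (k : nat) (H : amplification M k).

Local Notation Z i := (@coord_op R m H i).
Local Notation E a x := (@monomial_tensor R m L M k H a x).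

Let bZ i : bounded_operator (Z i) := bop_coord H i.

Lemma bop_tensor (y : 'rV[R[i]]_k) : bounded_operator (fun a => amp_tensor H a y).
Proof.
split=> [c u v|]; first by rewrite linearDl linearZl_LR.
(* The squared norm is [d * nrm a ^+ 2] with [d] the squared length of [y]; since
   [d <= (1 + d) ^+ 2], the constant [1 + d] spares a square root. *)
exists (1 + complex.Re (dotmx y y)) => a.
have d0 : 0 <= complex.Re (dotmx y y).
  have := dnorm_ge0 (@dotmx R[i] k) y.
  by rewrite lecE => /andP[].
rewrite -ler_sqr ?nnegrE ?mulr_ge0 ?nrm_ge0 ?addr_ge0 //.
rewrite sqr_nrm amp_dot dotE.
have -> : complex.Re ((nrm a ^+ 2)%:C * dotmx y y) = nrm a ^+ 2 * complex.Re (dotmx y y).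
  by case: (dotmx y y) => u v /=; rewrite mul0r subr0.
rewrite exprMn mulrC ler_wpM2r ?sqr_ge0 //.
by set d := complex.Re _ in d0 *; nra.
Qed.

(** Density in two stages: polynomials are dense in [M], which gives every elementary tensor with
    [x] fixed, and elementary tensors span a dense subspace of [H]. *)
Lemma monomials_dense (K : set H) : closed_subspace K ->
  (forall a x, K (E a x)) -> forall h, K h.
Proof.
move=> cK KE; suff KT a x : K (amp_tensor H a x).
  have : smallest (@closed_subspace R H) [set u | exists a x, u = amp_tensor H a x] `<=` K.
    by apply: smallest_sub => // _ [a [x ->]].
  by rewrite amp_dense => KH h; exact: KH.
have cKx := csub_preimage (bop_tensor x) cK.
suff : closure (range (wm_emb M)) `<=` [set a | K (amp_tensor H a x)].
  by rewrite wm_dense => /(_ a); exact.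
have [/closure_id -> _ _] := cKx; apply: closure_subset => _ [p _ <-].
elim/mpolyind: p => [|c b p _ _ Kp]; first by rewrite linear0; exact: (csub0 cKx).
by rewrite linearP; case: cKx => _ _; apply => //; exact: KE.
Qed.

Lemma bop_ext (H' : hilbertSpace R) (T U : H -> H') :
  bounded_operator T -> bounded_operator U ->
  (forall a x, T (E a x) = U (E a x)) -> T = U.
Proof.
by move=> bT bU TU; apply/funext; exact: (monomials_dense (csub_eq bT bU) TU).
Qed.

Lemma dot_ext (u v : H) :
  (forall a x, hs_dot H (E a x) u = hs_dot H (E a x) v) -> u = v.
Proof.
move=> uv; apply/eqP; rewrite -subr_eq0; apply/eqP/dot_injr => h.
rewrite dot0r; apply: (monomials_dense (csub_orth (u - v))) => a x /=.
by rewrite dotBr uv subrr.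
Qed.

Lemma dot_monomial a b x y : hs_dot H (E a x) (E b y) =
  if a == b then (L a ^+ 2)%:C * dotmx x y else 0.
Proof.
rewrite amp_dot; case: eqVneq => [<-|/eqP ab]; last by rewrite wm_orthogonal ?mul0r.
by rewrite -hs_normE wm_norm -rmorphXn.
Qed.

(** An amplification prescribes only the coordinate operators; all other polynomials follow by
    algebra induction. *)
Lemma act_tensor p a x : hm_act H p (amp_tensor H a x) = amp_tensor H (hm_act M p a) x.
Proof.
elim/mpoly_algebra_ind: p a => [a|i a|c p q hp hq a|p q hp hq a].
- by rewrite !hm_act1.
- exact: amp_act.
- by rewrite !hm_actD !hm_actZ hp hq linearDl linearZl_LR.
- by rewrite !hm_actM hq hp.
Qed.

Lemma act_monomial b a x : hm_act H (mpolyX R[i] b) (E a x) = E (mnm_add b a) x.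
Proof. by rewrite act_tensor wm_act -mpolyXD. Qed.

Lemma coord_monomial i a x : Z i (E a x) = E (mnm_add (mnm1 i) a) x.
Proof. exact: act_monomial. Qed.

Hypothesis hL : weight_set L.

(** [Z j] shifts an orthogonal family, so its adjoint shifts back; pairing with the vectors [E a y]
    determines the weight. *)
Lemma adj_coord_monomial j a x : adj (Z j) (E (mnm_add (mnm1 j) a) x) =
  (L (mnm_add (mnm1 j) a) ^+ 2 / L a ^+ 2)%:C *: E a x.
Proof.
apply: dot_ext => b y; rewrite -(adjP (bZ j)) coord_monomial dotZr !dot_monomial.
rewrite (inj_eq (@addmI _ _)); case: eqVneq => [->|_]; last by rewrite mulr0.
rewrite conjc_real mulrA -rmorphM /= divfK //.
by rewrite expf_neq0 // gt_eqF.
Qed.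

Lemma adj_tensor (l : 'I_k) b x :
  adj (fun a => amp_tensor H a (delta_mx 0 l)) (amp_tensor H b x) = x 0 l *: b.
Proof.
apply: dot_injr => c; rewrite -(adjP (bop_tensor _)) amp_dot dotZr mulrC.
by congr (_ * _); rewrite dotmxE -rowE !mxE.
Qed.

(** With [T_l] the map tensoring by the [l]-th basis vector, this is [\sum_l T_l T_l^* = 1]. It
    presents an operator [K (x) 1] as the finite sum of the [T_l K T_l^*], which carries compactness
    from [M] to [H]. *)
Lemma tensor_resolution h : \sum_(l < k)
  amp_tensor H (adj (fun a => amp_tensor H a (delta_mx 0 l)) h) (delta_mx 0 l) = h.
Proof.
pose T (l : 'I_k) a := amp_tensor H a (delta_mx 0 l).
have bT l : bounded_operator (T l) by exact: bop_tensor.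
have bS : bounded_operator (fun h => \sum_(l < k) T l (adj (T l) h)).
  by apply: bop_sum => l; exact: bop_comp (bT l) (bop_adj (bT l)).
apply: (monomials_dense (csub_eq bS (bop_id H))) => a x /=.
rewrite /T /monomial_tensor [in RHS](row_sum_delta x) linear_sumr.
by apply: eq_bigr => l _; rewrite adj_tensor linearZl_LR linearZr_LR.
Qed.

Lemma adj_coord_tensor j a x :
  adj (Z j) (amp_tensor H a x) = amp_tensor H (adj (@coord_op R m M j) a) x.
Proof.
apply: dot_ext => b y; rewrite -(adjP (bZ j)) amp_act !amp_dot.
by rewrite (adjP (bop_coord M j)).
Qed.

Lemma compact_amplified_commutators : cross_commutators_compact M ->
  forall i j, compact_operator (commutator (Z i) (adj (Z j))).
Proof.
move=> cM i j; have [A [[_ hA] cA]] := cM i j.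
have bi := bop_coord M i; have bj := bop_coord M j.
have eA : A = adj (@coord_op R m M j).
  by apply: (adj_uniq bj) => x y; exact: hA.
rewrite {}eA {hA} in cA; set K := commutator _ _ in cA.
have bK : bounded_operator K.
  by apply: bop_sub; [exact: bop_comp bi (bop_adj bj)|exact: bop_comp (bop_adj bj) bi].
have {cA}cK := compact_on_setT bK cA.
have bC : bounded_operator (commutator (Z i) (adj (Z j))).
  apply: bop_sub; [exact: bop_comp (bZ i) (bop_adj (bZ j))|].
  exact: bop_comp (bop_adj (bZ j)) (bZ i).
pose T (l : 'I_k) a := amp_tensor H a (delta_mx 0 l).
have : compact_operator (fun h => \sum_(l < k) T l (K (adj (T l) h))).
  apply: compact_sum => l; apply: (compact_compl (bop_tensor _)).
  exact: (compact_compr (bop_adj (bop_tensor _))).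
congr compact_operator; apply/funext => h.
rewrite -[in RHS](tensor_resolution h) (big_morph _ (bopD bC) (bop0 bC)).
apply: eq_bigr => l _; rewrite /T /K /commutator.
by rewrite adj_coord_tensor !amp_act adj_coord_tensor linearBl.
Qed.

End Amplification.

(** * Low degree in one variable *)

Section LowDegreePart.
Variables (R : realType) (m : nat) (L : multinom m -> R).
Variables (M : weightedModule L) (cM : cross_commutators_compact M).
Variables (k : nat) (H : amplification M k) (j : 'I_m).

Local Notation Zj := (@coord_op R m H j).
Local Notation E a x := (@monomial_tensor R m L M k H a x).

Let bZ : bounded_operator Zj := bop_coord H j.

(** Only the exponent of [z_j] is bounded, so this space may be infinite-dimensional and compactness
    on it is not automatic. *)
Definition low_degree (n : nat) : set H := smallest (@closed_subspace R H)
  [set u | exists (a : multinom m) x, (a j < n)%N /\ u = E a x].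

Local Notation F n := (proj (low_degree n)).

Let cW n : closed_subspace (low_degree n) := csub_smallest _.

Lemma proj_low_degree n (a : multinom m) x :
  F n (E a x) = if (a j < n)%N then E a x else 0.
Proof.
case: ltnP => ajn.
  by apply: (proj_id (cW n)); apply: sub_gen_smallest; exists a, x.
apply: (proj_uniq (cW n)); first exact: csub0 (cW n).
rewrite subr0 => s Ws; apply: dot_eq0C.
apply: (smallest_sub (csub_orth (E a x)) _ Ws) => _ [b [y [bjn ->]]] /=.
rewrite dot_monomial; case: eqVneq => // ba.
by move: bjn; rewrite ba ltnNge ajn.
Qed.

(** Checked on monomials, where [Zj] raises the exponent in position [j] by exactly one. *)
Lemma low_degree_coord n : F n.+1 \o Zj = Zj \o F n.
Proof.
have bF i := bop_proj (cW i).
apply: bop_ext; [exact: bop_comp (bF _) bZ|exact: bop_comp bZ (bF _)|].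
move=> a x /=; rewrite coord_monomial !proj_low_degree mnmDE mnm1E eqxx add1n ltnS.
by case: ifP => _; rewrite ?coord_monomial // (bop0 bZ).
Qed.

(* The commutator [Zj^*, Zj] being compact, Zj^* Zj F_n and Zj Zj^* F_n are
   compact together; the former is compact iff Zj F_n = F_(n+1) Zj is, the latter
   if Zj^* F_n is. *)
Lemma compact_adj_low_degree n : compact_operator (adj Zj \o F n).
Proof.
have bF i := bop_proj (cW i); have bB := bop_adj bZ.
elim: n => [|n IH].
  have -> : F 0 = fun=> 0.
    by apply: bop_ext; [exact: bF|exact: bop_zero|move=> a x; rewrite proj_low_degree].
  have := @compact_zero R H H; congr compact_operator; apply/funext => h /=.
  by rewrite (bop0 bB).
have cZF : compact_operator (Zj \o F n).
  apply: compact_of_adj_comp; first exact: bop_comp.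
  have -> : adj (Zj \o F n) = F n \o adj Zj.
    apply/esym/(adj_uniq (bop_comp bZ (bF n))) => x y /=.
    by rewrite (adjP bZ) (proj_dot (cW n)).
  (* With [B = adj Zj], [F_n B Zj F_n = F_n ([B, Zj] F_n + Zj B F_n)], and the induction hypothesis
     covers the second term. *)
  have cC := compact_commutatorC (compact_amplified_commutators H cM j j).
  have := compact_compl (bF n)
    (compact_add (compact_compr (bF n) cC) (compact_compl bZ IH)).
  by congr compact_operator; apply/funext => h; rewrite /commutator /= subrK.
have bU : bounded_operator (adj Zj \o F n.+1) by exact: bop_comp.
apply: (compact_of_adj_comp bU).
have -> : adj (adj Zj \o F n.+1) = Zj \o F n.
  rewrite -low_degree_coord; apply/esym/(adj_uniq bU) => x y /=.
  by rewrite (adjPl bZ) (proj_dot (cW n.+1)).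
exact: (compact_compr bU cZF).
Qed.

End LowDegreePart.

(** * Submodules generated by monomials *)

Section GeneratedSubmodule.
Variables (R : realType) (m : nat) (L : multinom m -> R) (hL : weight_set L).
Variables (M : weightedModule L) (cM : cross_commutators_compact M).
Variables (k : nat) (H : amplification M k).
Variables (n : nat) (alpha : 'I_n -> multinom m) (x : 'I_n -> 'rV[R[i]]_k).

Local Notation Z i := (@coord_op R m H i).
Local Notation E a x := (@monomial_tensor R m L M k H a x).

Let G := range (fun i => E (alpha i) (x i)).
Let S := generated_submodule G.

Lemma generated_submoduleP : submodule S.
Proof.
split; last first.
  move=> p h Sh B [sB GB]; case: (sB) => _; apply; exact: Sh.
split=> [||c u v Su Sv].
- by apply: closed_bigI => B /= [[[]]].
- by move=> B [[cB _] _]; exact: csub0 cB.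
- move=> B BG; have [[cB _] _] := BG.
  by case: (cB) => _ _; apply; [exact: Su|exact: Sv].
Qed.

Lemma generated_monomial i b : S (E (mnm_add b (alpha i)) (x i)).
Proof.
rewrite -act_monomial; case: generated_submoduleP => _; apply.
by apply: sub_gen_smallest; exists i.
Qed.

(** The closed span of the multiples of the generators is already a submodule, because coordinate
    operators send multiples to multiples; hence it contains [S]. *)
Lemma generated_submodule_sub (K : set H) : closed_subspace K ->
  (forall i b, K (E (mnm_add b (alpha i)) (x i))) -> S `<=` K.
Proof.
move=> cK KE.
pose G1 := [set u | exists i b, u = E (mnm_add b (alpha i)) (x i)].
pose S1 := smallest (@closed_subspace R H) G1.
have cS1 : closed_subspace S1 by exact: csub_smallest.
have S1act p h : S1 h -> S1 (hm_act H p h).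
  elim/mpoly_algebra_ind: p h => [h|j h|c p q hp hq h S1h|p q hp hq h S1h].
  - by rewrite hm_act1.
  - apply: (smallest_sub (csub_preimage (bop_act H _) cS1)) => _ [i [b ->]] /=.
    apply: sub_gen_smallest; exists i, (mnm_add (mnm1 j) b).
    by rewrite act_monomial addmA.
  - by rewrite hm_actD hm_actZ; case: (cS1) => _ _; apply; [exact: hp|exact: hq].
  - by rewrite hm_actM; apply: hp; exact: hq.
have SS1 : S `<=` S1.
  apply: smallest_sub => // _ [i _ <-]; apply: sub_gen_smallest.
  by exists i, mnm0; rewrite add0m.
by move=> h /SS1; apply: smallest_sub => // _ [i [b ->]].
Qed.

(** Inserting [F_N] before [adj (Z j)] makes the operator compact; on [S] this changes nothing, as
    is checked on multiples of the generators. *)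
Lemma compact_generated_off_corner j :
  compact_operator ((fun h => h - proj S h) \o adj (Z j) \o proj S).
Proof.
have [cS _] := generated_submoduleP.
have bB := bop_adj (bop_coord H j).
have bQ : bounded_operator (fun h => h - proj S h).
  by apply: bop_sub; [exact: bop_id|exact: bop_proj].
(* One more than the largest exponent of [z_j] in a generator; without generators the maximum is
   [0]. *)
pose N := (\max_(i < n) alpha i j).+1.
have cW : closed_subspace (low_degree (H := H) j N) by exact: csub_smallest.
have bF := bop_proj cW.
have := compact_compl bQ (compact_compr (bop_proj cS) (compact_adj_low_degree cM H j N)).
congr compact_operator; apply/funext => h /=.
have bT := bop_comp bQ bB; have bU := bop_comp bT bF.
apply: (generated_submodule_sub (csub_eq bU bT) _ (proj_in cS h)) => i b /=.
rewrite proj_low_degree; case: ltnP => // Nb.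
(* A total exponent of at least [N] exceeds that of the generator, so [z_j] divides the multiplier
   [Z^b] and one factor [z_j] can be removed without leaving [S]. *)
have b0 : b j != 0%N.
  apply: contraTneq Nb => b0; rewrite -ltnNge mnmDE b0 add0n ltnS.
  exact: (leq_bigmax (F := fun i => alpha i j) i).
(* The side with [F_N] vanishes; on the other, the adjoint yields a scalar multiple of a monomial of
   [S], which [1 - P] kills. *)
rewrite (bop0 bB) (bop0 (bop_proj cS)) subr0; apply/esym.
rewrite -(submK (_ : lem (mnm1 j) b)) ?lep1mP // (addmC _ (mnm1 j)) -addmA.
rewrite (adj_coord_monomial _ hL) (proj_id cS) ?subrr //.
by apply: (csubZ cS); exact: generated_monomial.
Qed.

End GeneratedSubmodule.

Theorem theorem9 (R : realType) (m : nat) (hm : (1 <= m)%N)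
    (L : multinom m -> R) (hL : weight_set L)
    (hstar : weights_nonincreasing L)
    (M : weightedModule L) (hstar2 : cross_commutators_compact M)
    (k : nat) (hk : (1 <= k)%N) (H : amplification M k)
    (n : nat) (alpha : 'I_n -> multinom m) (x : 'I_n -> 'rV[R[i]]_k) :
  essentially_reductive
    (generated_submodule (range (fun i => monomial_tensor H (alpha i) (x i)))).
Proof.
have sS := generated_submoduleP H alpha x; have [cS _] := sS.
apply: (essentially_reductive_compression cS sS).
- exact: compact_amplified_commutators.
- exact: compact_generated_off_corner.
Qed.
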